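(* Let $\mathbb K$ be any field, let $k$ be a positive integer, and let $\mathcal A=\{H_1,\dots,H_n\}$ be a central essential arrangement of $n$ distinct hyperplanes in $\mathbb K^k$, where $H_i$ is the vanishing locus of a nonzero linear form $L_i\in R=\mathbb K[x_1,\dots,x_k]$. Assume that $\mathcal A$ is $k-2$ generic, i.e. any $k-1$ of the linear forms $L_1,\dots,L_n$ are linearly independent. Let $$I_{n-k+2}(\mathcal A)=\langle\{L_{i_1}\cdots L_{i_{n-k+2}} : 1\le i_1<\cdots<i_{n-k+2}\le n\}\rangle\subset R.$$ Then $$I_{n-k+2}(\mathcal A)=\bigcap_{X\in L_{k-1}(\mathcal A)}I(X)^{\nu(X)-k+2}.$$
   Context: ''Central'' means that all the hyperplanes pass through the origin; ''essential'' means that $\operatorname{codim}(H_1\cap\cdots\cap H_n)=k$, i.e. $L_1,\dots,L_n$ span the space of linear forms in $R$. A flat of $\mathcal A$ is a linear subspace $X\subseteq\mathbb K^k$ that is an intersection of some of the hyperplanes of $\mathcal A$ (the empty intersection being $\mathbb K^k$); its rank is its codimension. $L_j(\mathcal A)$ denotes the set of flats of rank $j$; the flats of rank $k-1$ are called coatoms. For a flat $X$, $\nu(X)$ is the number of hyperplanes $H_i\in\mathcal A$ containing $X$, and $I(X)\subset R$ is the ideal of $X$, i.e. the ideal generated by all linear forms vanishing on $X$ (equivalently, by the $L_i$ with $X\subseteq H_i$). An empty set of products generates the zero ideal. *)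

(* Defs.v *)
From HB Require Import structures.
From mathcomp Require Import all_boot all_algebra.
From mathcomp Require Import classical_sets.
From mathcomp Require Import mpoly.

Set Implicit Arguments.
Unset Strict Implicit.
Unset Printing Implicit Defensive.

Import GRing.Theory.

Local Open Scope ring_scope.

Section Ideals.
Variable R : comNzRingType.

(* The unit ideal is allowed, unlike in [idealr_closed]. *)
Definition is_ideal (I : set R) : Prop :=
  [/\ I 0, forall p q, I p -> I q -> I (p + q) & forall r p, I p -> I (r * p)].

Definition ideal_gen (G : set R) : set R := smallest is_ideal G.

(* For m = 0 the only product is 1, so [ideal_pow I 0] is the whole ring. *)
Definition ideal_pow (I : set R) (m : nat) : set R :=
  ideal_gen (fun p => exists2 f : 'I_m -> R,
                        forall j, I (f j) & p = \prod_(j < m) f j).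

End Ideals.

Definition lin_indep (K : fieldType) (V : lmodType K) (T : finType)
    (S : {set T}) (v : T -> V) : Prop :=
  forall c : T -> K, \sum_(i in S) c i *: v i = 0 -> forall i, i \in S -> c i = 0.

Section Arrangements.
Variables (K : fieldType) (k : nat).

Definition linear_form (l : {mpoly K[k]}) : bool := l \is 1.-homog.

Definition form_eval (l : {mpoly K[k]}) (v : 'rV[K]_k) : K^o := l.@[v 0].

(* [linfun] is only meaningful on linear functions; see [mem_hyperplane]. *)
Definition hyperplane (l : {mpoly K[k]}) : {vspace 'rV[K]_k} :=
  lker (linfun (form_eval l)).

Lemma form_eval_linear (l : {mpoly K[k]}) :
  linear_form l -> linear (form_eval l).
Proof.
move=> /dhomogP hl a u v; rewrite /form_eval !mevalE scaler_sumr -big_split /=.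
rewrite big_seq [RHS]big_seq; apply: eq_bigr => m hm.
have /eqP := hl m hm; rewrite mdeg_eq1 => /existsP[i /eqP ->].
have E (w : 'rV[K]_k) : \prod_j w 0 j ^+ U_(i)%MM j = w 0 i.
  rewrite (bigD1 i) //= mnm1E eqxx expr1 big1 ?mulr1 // => j nji.
  by rewrite mnm1E eq_sym (negbTE nji).
rewrite !E !mxE mulrDr; congr (_ + _).
by rewrite -[RHS]/(a * (l@_(U_(i)%MM) * u 0 i)) mulrCA.
Qed.

Lemma mem_hyperplane (l : {mpoly K[k]}) (v : 'rV[K]_k) :
  linear_form l -> (v \in hyperplane l) = (l.@[v 0] == 0).
Proof.
move=> hl.
pose F := GRing.isLinear.Build K 'rV[K]_k K^o *:%R (form_eval l)
  (form_eval_linear hl).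
pose f : {linear 'rV[K]_k -> K^o} := HB.pack (form_eval l) F.
by rewrite memv_ker (lfunE f).
Qed.

Definition codim (X : {vspace 'rV[K]_k}) : nat := (k - \dim X)%N.

Definition form_ideal (X : {vspace 'rV[K]_k}) : set {mpoly K[k]} :=
  ideal_gen (fun l => linear_form l /\ forall v, v \in X -> l.@[v 0] = 0).

Section Family.
Variables (n : nat) (L : 'I_n -> {mpoly K[k]}).

Definition essential : Prop := codim (\bigcap_(i < n) hyperplane (L i))%VS = k.

(* m-genericity is [all_indep m.+1]; indexing by the number of forms keeps the
   case k = 1, where k - 2 = -1, meaningful. *)
Definition all_indep (r : nat) : Prop :=
  forall S : {set 'I_n}, #|S| = r -> lin_indep S L.

Definition flats (j : nat) : set {vspace 'rV[K]_k} :=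
  fun X => (exists S : {set 'I_n}, X = (\bigcap_(i in S) hyperplane (L i))%VS)
           /\ codim X = j.

Definition nu (X : {vspace 'rV[K]_k}) : nat :=
  #|[set i | (X <= hyperplane (L i))%VS]|.

Definition fold_products_ideal (a : nat) : set {mpoly K[k]} :=
  ideal_gen (fun p => exists2 S : {set 'I_n}, #|S| = a & p = \prod_(i in S) L i).

End Family.
End Arrangements.

(* Main.v *)
(* The products of n-k+2 forms visibly vanish to order nu(X)-k+2 along every
   coatom X. For the converse, let f vanish to these orders and induct on k and
   n by deletion and restriction. The forms L_2, ..., L_n restricted to H_1 are
   n-1 forms in k-1 variables, any k-2 of them independent; the coatoms of the
   restriction are the coatoms of the arrangement inside H_1, with nu smaller by
   one, so the prescribed order does not change. Hence f restricted to H_1 is a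
   combination of products of n-k+2 restricted forms; lifting it gives f = g +
   L_1 h with g in I_(n-k+2). Then h has the vanishing orders prescribed for
   L_2, ..., L_n, and the products obtained for h are completed by the factor
   L_1. The induction goes through because repeated hyperplanes, zero forms
   and non-essential arrangements are allowed.

   Of membership in I(X)^m only the consequence that f(s v + t x) is divisible
   by t^m, where v spans X, is used in the converse. *)
Require Import Defs.
From HB Require Import structures.
From mathcomp Require Import all_boot all_algebra.
From mathcomp Require Import classical_sets.
From mathcomp Require Import mpoly.
From mathcomp Require Import ring zify.

Set Implicit Arguments.
Unset Strict Implicit.
Unset Printing Implicit Defensive.

Import GRing.Theory.

Local Open Scope ring_scope.

(** * Ideals, their powers, and products of forms *)

Section IdealTheory.
Variable R : comNzRingType.
Implicit Types I G : set R.

Lemma ideal_gen_is_ideal G : is_ideal (ideal_gen G).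
Proof.
split=> [I [[I0 _ _] _] //|p q Ip Iq I [idI GI]|r p Ip I [idI GI]].
  by case: (idI) => _ ID _; apply: ID; [apply: Ip|apply: Iq].
by case: (idI) => _ _; apply; apply: Ip.
Qed.

Lemma ideal_gen_incl G : (G `<=` ideal_gen G)%classic.
Proof. exact: sub_gen_smallest. Qed.

Lemma ideal_gen_sub G I : is_ideal I -> (G `<=` I)%classic ->
  (ideal_gen G `<=` I)%classic.
Proof. exact: smallest_sub. Qed.

Lemma ideal_pow_is_ideal I m : is_ideal (ideal_pow I m).
Proof. exact: ideal_gen_is_ideal. Qed.

Lemma ideal_pow_subset I I' m : (I `<=` I')%classic ->
  (ideal_pow I m `<=` ideal_pow I' m)%classic.
Proof.
move=> sII'; apply: ideal_gen_sub; first exact: ideal_gen_is_ideal.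
by move=> p [f If ->]; apply: ideal_gen_incl; exists f => // j; apply: sII'.
Qed.

Lemma prod_mem_ideal_pow I (T : finType) (F : T -> R) (S : {set T}) m :
  (forall i, i \in S -> I (F i)) -> #|S| = m ->
  ideal_pow I m (\prod_(i in S) F i).
Proof.
move=> IF <-; apply: ideal_gen_incl.
exists (fun j => F (enum_val j)); last by rewrite big_enum_val.
by move=> j; apply: IF; apply: enum_valP.
Qed.

End IdealTheory.

Lemma subset_of_card (T : finType) (A : {set T}) m :
  (m <= #|A|)%N -> exists2 B : {set T}, B \subset A & #|B| = m.
Proof.
move=> /card_geqP [s [us <- sA]]; exists [set x in s].
  by apply/fintype.subsetP => x; rewrite inE; apply: sA.
by rewrite cardsE; apply/card_uniqP.
Qed.

Lemma fold_products_is_ideal (K : fieldType) (k n : nat)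
    (L : 'I_n -> {mpoly K[k]}) a : is_ideal (fold_products_ideal L a).
Proof. exact: ideal_gen_is_ideal. Qed.

(** By inclusion-exclusion, [a] of the [n] indices meet [Z] in at least [a + #|Z| - n] elements; [m]
    of these give factors in [I], and the remaining factors act as a coefficient. *)
Lemma fold_products_sub_pow (K : fieldType) (k n : nat)
    (L : 'I_n -> {mpoly K[k]}) (I : set {mpoly K[k]}) (Z : {set 'I_n}) a m :
  (forall i, i \in Z -> I (L i)) -> (m <= a + #|Z| - n)%N ->
  (fold_products_ideal L a `<=` ideal_pow I m)%classic.
Proof.
move=> IL lem; apply: ideal_gen_sub; first exact: ideal_gen_is_ideal.
move=> _ [S cS ->].
have [T /fintype.subsetP sT cT] : exists2 T : {set 'I_n}, T \subset S :&: Z & #|T| = m.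
  have leU : (#|S :|: Z| <= n)%N by rewrite -[leqRHS]card_ord max_card.
  apply: subset_of_card; move: (cardsUI S Z) leU lem; rewrite cS; lia.
have [_ _ powM] := ideal_pow_is_ideal I m.
have sTS : T \subset S by apply/fintype.subsetP => i /sT /setIP[].
rewrite (big_setID T) /= (finset.setIidPr sTS) mulrC; apply: powM.
by apply: prod_mem_ideal_pow cT => i /sT /setIP[_ /IL].
Qed.

(** * Linear forms and linear substitutions *)

Section Forms.
Variable K : fieldType.

Definition lin k (a : 'rV[K]_k) : {mpoly K[k]} := \sum_j a 0 j *: 'X_j.

Lemma lin_is_linear k : linear (@lin k).
Proof.
move=> c a b; rewrite /lin scaler_sumr -big_split; apply: eq_bigr => j _ /=.
by rewrite !mxE scalerDl scalerA.
Qed.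

HB.instance Definition _ k := GRing.isLinear.Build K 'rV[K]_k {mpoly K[k]} *:%R
  (@lin k) (@lin_is_linear k).

Lemma mcoeff_lin k (a : 'rV[K]_k) j : (lin a)@_(U_(j)) = a 0 j.
Proof.
rewrite /lin raddf_sum (bigD1 j) //= mcoeffZ mcoeffXU eqxx mulr1.
by rewrite big1 ?addr0 // => i nij; rewrite mcoeffZ mcoeffXU (negbTE nij) mulr0.
Qed.

Lemma lin_form k (a : 'rV[K]_k) : linear_form (lin a).
Proof.
by rewrite /linear_form /lin rpred_sum // => j _; rewrite rpredZ // dhomogX /= mdeg1.
Qed.

Lemma form_lin k (l : {mpoly K[k]}) :
  linear_form l -> l = lin (\row_j l@_(U_(j))).
Proof.
move=> hl; apply/mpolyP => m.
have [md1|md1] := eqVneq (mdeg m) 1%N.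
  have /eqP := md1; rewrite mdeg_eq1 => /existsP[i /eqP ->].
  by rewrite mcoeff_lin mxE.
by rewrite (dhomog_nemf_coeff hl md1) (dhomog_nemf_coeff (lin_form _) md1).
Qed.

Lemma meval_lin k (a : 'rV[K]_k) (v : 'cV[K]_k) :
  (lin a).@[v^T 0] = (a *m v) 0 0.
Proof.
rewrite /lin raddf_sum mxE; apply: eq_bigr => j _ /=.
by rewrite mevalZ mevalXU mxE.
Qed.

Lemma mpoly_ring_ind k (P : {mpoly K[k]} -> Prop) :
  (forall c, P c%:MP) -> (forall i, P 'X_i) ->
  (forall p q, P p -> P q -> P (p + q)) ->
  (forall p q, P p -> P q -> P (p * q)) -> forall p, P p.
Proof.
move=> PC PX PD PM; elim/mpolyind => [|c m p _ _ Pp].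
  by rewrite -mpolyC0; apply: PC.
have P1 : P 1 by rewrite -mpolyC1; apply: PC.
apply: (PD) Pp; rewrite -mul_mpolyC mpolyXE_id; apply: (PM) => //.
apply: big_ind => // i _; elim: (m i) => [//|e IHe].
by rewrite exprS; apply: PM.
Qed.

Lemma mpoly_rmorph_ext k (S : nzRingType) (F G : {rmorphism {mpoly K[k]} -> S}) :
  (forall c, F c%:MP = G c%:MP) -> (forall i, F 'X_i = G 'X_i) -> F =1 G.
Proof.
move=> FGC FGX p; elim/mpoly_ring_ind: p => // p q Fp Fq.
  by rewrite !rmorphD Fp Fq.
by rewrite !rmorphM Fp Fq.
Qed.

(** This is the pullback [f(M x)] along [M] acting on column vectors; for a parametrization [M] of a
    hyperplane it is restriction to that hyperplane. *)
Definition mxsubst m k (M : 'M[K]_(m, k)) : {mpoly K[m]} -> {mpoly K[k]} :=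
  comp_mpoly [tuple lin (row i M) | i < m].

HB.instance Definition _ m k (M : 'M[K]_(m, k)) :=
  GRing.RMorphism.copy (mxsubst M) (mxsubst M).
HB.instance Definition _ m k (M : 'M[K]_(m, k)) :=
  GRing.Linear.copy (mxsubst M) (mxsubst M).

Lemma mxsubstX m k (M : 'M[K]_(m, k)) i : mxsubst M 'X_i = lin (row i M).
Proof. by rewrite /mxsubst comp_mpolyXU -tnth_nth tnth_mktuple. Qed.

Lemma mxsubstC m k (M : 'M[K]_(m, k)) c : mxsubst M c%:MP = c%:MP.
Proof. exact: comp_mpolyC. Qed.

Lemma mxsubst_lin m k (M : 'M[K]_(m, k)) a : mxsubst M (lin a) = lin (a *m M).
Proof.
rewrite {1}/lin linear_sum mulmx_sum_row linear_sum; apply: eq_bigr => j _.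
by rewrite !linearZ /= mxsubstX.
Qed.

Lemma mxsubst_comp m k l (M : 'M[K]_(m, k)) (N : 'M[K]_(k, l)) f :
  mxsubst N (mxsubst M f) = mxsubst (M *m N) f.
Proof.
apply: (@mpoly_rmorph_ext _ _ (mxsubst N \o mxsubst M) (mxsubst (M *m N))) => [c|i] /=.
  by rewrite !mxsubstC.
by rewrite !mxsubstX mxsubst_lin row_mul.
Qed.

Lemma mxsubst1 k f : mxsubst (1%:M : 'M[K]_k) f = f.
Proof.
apply: (@mpoly_rmorph_ext _ _ (mxsubst 1%:M) idfun) => [c|i] /=.
  by rewrite mxsubstC.
rewrite mxsubstX /lin (bigD1 i) //= !mxE eqxx scale1r big1 ?addr0 // => j nji.
by rewrite !mxE eq_sym (negbTE nji) scale0r.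
Qed.

(** * Order of vanishing along a line *)

Lemma polyX_neq0 (A : nzRingType) : 'X != 0 :> {poly A}.
Proof. by rewrite polyX_eq0. Qed.

(** As long as a factor ['X] remains on the right, evaluation at 0 forces [q] to have the root 0, so
    the factors are cancelled one at a time. *)
Lemma Xn_dvd_cancel (A : idomainType) (p q r : {poly A}) m :
  p.[0] != 0 -> p * q = r * 'X^m -> exists s, q = s * 'X^m.
Proof.
move=> p0; elim: m q r => [|m IHm] q r; first by exists q; rewrite mulr1.
rewrite exprSr mulrA => pq; have /factor_theorem[q1] : root q 0.
  have /eqP := congr1 (fun u => u.[0]) pq.
  by rewrite /root /= !hornerM hornerX mulr0 mulf_eq0 (negbTE p0).
rewrite subr0 => def_q; move: pq; rewrite def_q mulrA.
by move=> /(mulIf (polyX_neq0 _)) /IHm [s ->]; exists s; rewrite mulrA.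
Qed.

(* Expands [f] along [v], as [f (s v + t x)]: the outer variable is [t], the
   inner one is [s]. The order in [t] of this polynomial is the order of
   vanishing of [f] along the line spanned by [v]. *)
Definition ray k (v : 'cV[K]_k) : {mpoly K[k]} -> {poly {poly {mpoly K[k]}}} :=
  mmap (polyC \o polyC \o @mpolyC k K)
    (fun i => ((v i 0)%:MP *: 'X)%:P + ('X_i)%:P *: 'X).

HB.instance Definition _ k (v : 'cV[K]_k) :=
  GRing.RMorphism.copy (ray v) (ray v).

Lemma rayC k (v : 'cV[K]_k) c : ray v c%:MP = c%:MP%:P%:P.
Proof. by rewrite /ray mmapC. Qed.

Lemma rayX k (v : 'cV[K]_k) i :
  ray v 'X_i = ((v i 0)%:MP *: 'X)%:P + ('X_i)%:P *: 'X.
Proof. by rewrite /ray mmapX mmap1U. Qed.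

Lemma ray_lin k (v : 'cV[K]_k) a :
  ray v (lin a) = (((a *m v) 0 0)%:MP *: 'X)%:P + (lin a)%:P *: 'X.
Proof.
rewrite {1}/lin rmorph_sum mxE /lin !raddf_sum /= scaler_suml rmorph_sum.
rewrite scaler_suml -big_split; apply: eq_bigr => j _ /=.
rewrite -!mul_mpolyC rmorphM /= rayC rayX mulrDr !mpolyCM.
by rewrite -scalerA -!mul_polyC !polyCM -!mulrA.
Qed.

Definition vanishing k (v : 'cV[K]_k) m : set {mpoly K[k]} :=
  fun f => exists q, ray v f = q * 'X^m.

Lemma vanishing_is_ideal k (v : 'cV[K]_k) m : is_ideal (vanishing v m).
Proof.
split=> [|p q [p1 def_p] [q1 def_q]|r p [p1 def_p]].
- by exists 0; rewrite rmorph0 mul0r.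
- by exists (p1 + q1); rewrite rmorphD /= def_p def_q mulrDl.
- by exists (ray v r * p1); rewrite rmorphM /= def_p mulrA.
Qed.

(** Since [ray v] is a ring morphism, orders in [t] add up in products. *)
Lemma ideal_pow_vanishing k (v : 'cV[K]_k) m :
  (ideal_pow (vanishing v 1) m `<=` vanishing v m)%classic.
Proof.
apply: ideal_gen_sub; first exact: vanishing_is_ideal.
(* The boolean equality lets [xchoose] select a quotient for every factor. *)
move=> _ [f vf ->]; have {}vf j : exists q, ray v (f j) == q * 'X.
  by have [q ->] := vf j; exists q.
exists (\prod_j xchoose (vf j)).
rewrite rmorph_prod -[m in 'X^m]card_ord -prodr_const -big_split /=.
by apply: eq_bigr => j _; apply/eqP/(xchooseP (vf j)).
Qed.

Lemma vanishing_lin k (v : 'cV[K]_k) a : a *m v = 0 -> vanishing v 1 (lin a).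
Proof.
move=> av; exists (lin a)%:P%:P.
by rewrite ray_lin av mxE mpolyC0 scale0r add0r mul_polyC.
Qed.

(** The form [a] becomes [(a v) s + (lin a) t] on the ray. If [a v] is nonzero, this is prime to [t]
    and no order is lost; otherwise it is [t] times a nonzero constant in [t], and exactly one order
    is lost. *)
Lemma vanishing_lin_mul k (v : 'cV[K]_k) a h m :
  a != 0 -> vanishing v m (lin a * h) ->
  vanishing v (m - (a *m v == 0)%R) h.
Proof.
move=> a0 [q]; rewrite rmorphM /= ray_lin.
have lin_a0 : lin a != 0.
  apply: contraNneq a0 => la0; apply/eqP/rowP => j.
  by rewrite -mcoeff_lin la0 mcoeff0 mxE.
have [->|av0] := eqVneq (a *m v) 0; last first.
  rewrite subn0; apply: Xn_dvd_cancel.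
  rewrite hornerD hornerC hornerZ hornerX mulr0 addr0.
  rewrite -mul_polyC mulf_eq0 polyC_eq0 polyX_eq0 orbF.
  rewrite mpolyC_eq0; apply: contraNneq av0 => av0.
  by apply/eqP/matrixP => i j; rewrite !ord1 av0 mxE.
rewrite mxE mpolyC0 scale0r add0r; case: m => [|m].
  by exists (ray v h); rewrite mulr1.
rewrite subn1 /= -mul_polyC exprSr mulrA mulrAC => /(mulIf (polyX_neq0 _)).
by apply: Xn_dvd_cancel; rewrite hornerC polyC_eq0.
Qed.

(** As [M (s v + t x) = s (M v) + t (M x)], the ray of the pullback is the ray of [f] along [M v]
    with its coefficients pulled back. *)
Lemma vanishing_mxsubst m k (M : 'M[K]_(m, k)) (v : 'cV[K]_k) e f :
  vanishing (M *m v) e f -> vanishing v e (mxsubst M f).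
Proof.
have rayM : ray v (mxsubst M f) =
    map_poly (map_poly (mxsubst M)) (ray (M *m v) f).
  apply: (@mpoly_rmorph_ext _ _ (ray v \o mxsubst M)
           (map_poly (map_poly (mxsubst M)) \o ray (M *m v))) => [c|i] /=.
    by rewrite mxsubstC !rayC map_polyC /= map_polyC /= mxsubstC.
  rewrite mxsubstX ray_lin rayX -row_mul mxE rmorphD /= map_polyC /=.
  by rewrite !map_polyZ /= !map_polyX mxsubstC map_polyC /= mxsubstX.
move=> [q def_f]; exists (map_poly (map_poly (mxsubst M)) q).
by rewrite rayM def_f rmorphM /= map_polyXn.
Qed.

(* Setting [t = 0] and [s = x] in [f (s v + t x)], with [v = 1], recovers [f]. *)
Lemma vanishing_univariate (f : {mpoly K[1]}) :
  vanishing (const_mx 1) 1 f -> f = 0.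
Proof.
move=> [q def_f]; have : (ray (const_mx 1) f).[0].['X_0] = f.
  apply: (@mpoly_rmorph_ext _ _
    (horner_eval 'X_0 \o horner_eval 0 \o ray (const_mx 1)) idfun) => [c|i] /=.
    by rewrite rayC /horner_eval !hornerE.
  by rewrite rayX ord1 mxE /horner_eval !hornerE.
by rewrite def_f !hornerE.
Qed.

(** * Deletion and restriction *)

(* [M] parametrizes the hyperplane [a = 0] by one variable less, and [N] is a
   retraction of it. *)
Lemma hyperplane_splitting k (a : 'rV[K]_k.+1) : a != 0 ->
  exists (M : 'M[K]_(k.+1, k)) (N : 'M[K]_(k, k.+1)) (u : 'cV[K]_k.+1),
    [/\ a *m M = 0, N *m M = 1%:M & u *m a + M *m N = 1%:M].
Proof.
(* [a] is the scalar [c] times the first row of [B], so in the coordinates [B x] the hyperplane is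
   where the first one vanishes. Hence [M] consists of the last [k] columns of the inverse of [B],
   [N] of the last [k] rows of [B], and [u] is the first column of the inverse, rescaled. *)
move=> a0; pose B : 'M_(1 + k) := row_ebase a; pose c := col_ebase a.
have cU : c \in unitmx by apply: col_ebase_unit.
have BU : B \in unitmx by apply: row_ebase_unit.
have def_a : a = c *m usubmx B.
  rewrite -[LHS]mulmx_ebase rank_rV a0 -mulmxA; congr (_ *m _).
  transitivity (row_mx 1%:M 0 *m col_mx (usubmx B) (dsubmx B)).
    by rewrite vsubmxK -pid_mx_row.
  by rewrite mul_row_col mul1mx mul0mx addr0.
have CB : lsubmx (invmx B) *m usubmx B + rsubmx (invmx B) *m dsubmx B = 1%:M.
  by rewrite -mul_row_col hsubmxK vsubmxK mulVmx.
have /eq_block_mx [_ BM _ NM] : block_mx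
    (usubmx B *m lsubmx (invmx B)) (usubmx B *m rsubmx (invmx B))
    (dsubmx B *m lsubmx (invmx B)) (dsubmx B *m rsubmx (invmx B))
    = block_mx 1%:M 0 0 1%:M.
  by rewrite -mul_col_row hsubmxK vsubmxK mulmxV // -scalar_mx_block.
exists (rsubmx (invmx B)), (dsubmx B), (lsubmx (invmx B) *m invmx c); split=> //.
  by rewrite def_a -mulmxA BM mulmx0.
by rewrite def_a mulmxA mulmxKV.
Qed.

Lemma fold_products_deletion k n (L : 'I_n.+1 -> {mpoly K[k]}) m f :
  fold_products_ideal (fun i => L (lift ord0 i)) m f ->
  fold_products_ideal L m.+1 (L ord0 * f).
Proof.
move: f; apply: ideal_gen_sub.
  have [I0 ID IM] := fold_products_is_ideal L m.+1.
  split=> [|p q Ip Iq|r p Ip]; rewrite ?mulr0 ?mulrDr //; first exact: ID.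
  by rewrite mulrCA; apply: IM.
move=> _ [S cS ->]; apply: ideal_gen_incl.
have S0 : ord0 \notin [set lift ord0 i | i in S].
  by apply/imsetP => -[i _ /eqP]; rewrite (negbTE (neq_lift _ _)).
exists (ord0 |: [set lift ord0 i | i in S]).
  by rewrite cardsU1 S0 card_imset ?cS //; apply: lift_inj.
rewrite big_setU1 //= big_imset // => i j _ _; apply: lift_inj.
Qed.

Lemma fold_products_restriction k l n (M : 'M[K]_(k, l)) (N : 'M[K]_(l, k))
    (a : 'I_n.+1 -> 'rV[K]_k) m g :
  N *m M = 1%:M ->
  fold_products_ideal (fun i => lin (a (lift ord0 i) *m M)) m g ->
  exists2 f, fold_products_ideal (fun i => lin (a i)) m f & mxsubst M f = g.
Proof.
move=> NM; have [I0 ID IM] := fold_products_is_ideal (fun i => lin (a i)) m.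
move: g; apply: ideal_gen_sub.
  split=> [|_ _ [p Ip <-] [q Iq <-]|r _ [p Ip <-]].
  - by exists 0; rewrite ?rmorph0.
  - by exists (p + q); rewrite ?rmorphD //; apply: ID.
  (* The retraction [N] lifts the coefficient [r], because [N *m M] is the identity. *)
  - exists (mxsubst N r * p); first exact: IM.
    by rewrite rmorphM /= mxsubst_comp NM mxsubst1.
move=> _ [S cS ->]; exists (\prod_(i in S) lin (a (lift ord0 i))).
  apply: ideal_gen_incl; exists [set lift ord0 i | i in S].
    by rewrite card_imset //; apply: lift_inj.
  rewrite big_imset // => i j _ _; apply: lift_inj.
by rewrite rmorph_prod; apply: eq_bigr => i _; rewrite /= mxsubst_lin.
Qed.

(** Modulo [lin a], substituting [M *m N = 1 - u *m a] is the identity: this is checked on variables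
    and carried through sums and products. If [f] restricts to 0, its substitution vanishes, leaving
    [f] itself divisible. *)
Lemma mxsubst_ker k l (M : 'M[K]_(k, l)) (N : 'M[K]_(l, k)) u a f :
  u *m a + M *m N = 1%:M -> mxsubst M f = 0 -> exists h, f = lin a * h.
Proof.
move=> uaMN Mf0.
suff [h def_f] : exists h, f - mxsubst (M *m N) f = lin a * h.
  by exists h; rewrite -def_f -mxsubst_comp Mf0 rmorph0 subr0.
elim/mpoly_ring_ind: f {Mf0} => [c|i|p q [g def_p] [h def_q]|p q [g def_p] [h def_q]].
- by exists 0; rewrite mxsubstC subrr mulr0.
- exists (u i 0)%:MP; rewrite -[X in X - _]mxsubst1 !mxsubstX -linearB /= -raddfB.
  rewrite -uaMN addrK mulrC mul_mpolyC -linearZ /=; congr lin.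
  by apply/rowP => j; rewrite !mxE big_ord1.
- by exists (g + h); rewrite rmorphD opprD addrACA def_p def_q mulrDr.
- exists (g * q + mxsubst (M *m N) p * h); rewrite rmorphM /=.
  by rewrite mulrDr mulrA [lin a * (_ * h)]mulrCA -def_p -def_q; ring.
Qed.

(** * Coatom vectors and the induction *)

Section Coatoms.
Variables (k n : nat) (a : 'I_n -> 'rV[K]_k).

(* [v] spans a flat of dimension one. *)
Definition coatom_vector (v : 'cV[K]_k) : Prop :=
  v != 0 /\ forall w : 'cV[K]_k,
    (forall i, a i *m v = 0 -> a i *m w = 0) -> exists c, w = c *: v.

Definition forms_through (v : 'cV[K]_k) : {set 'I_n} :=
  [set i | a i *m v == 0].
End Coatoms.


Lemma vanishing_le k (v : 'cV[K]_k) m m' :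
  (m' <= m)%N -> (vanishing v m `<=` vanishing v m')%classic.
Proof.
move=> le_m' f [q def_f]; exists (q * 'X^(m - m')).
by rewrite def_f -mulrA -exprD subnK.
Qed.

Lemma fold_products_vanishing k n (a : 'I_n -> 'rV[K]_k) v m :
  (fold_products_ideal (fun i => lin (a i)) m
    `<=` vanishing v (m + #|forms_through a v| - n))%classic.
Proof.
move=> f If; apply: ideal_pow_vanishing.
apply: (fold_products_sub_pow (Z := forms_through a v) _ _ If) => // i.
by rewrite inE => /eqP; apply: vanishing_lin.
Qed.

Lemma fold_products0 k n (L : 'I_n -> {mpoly K[k]}) f :
  fold_products_ideal L 0 f.
Proof.
have [_ _ IM] := fold_products_is_ideal L 0.
rewrite -[f]mulr1; apply: IM; apply: ideal_gen_incl.
by exists finset.set0; rewrite ?cards0 // big_set0.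
Qed.

Lemma indep_neq0 k n (a : 'I_n.+1 -> 'rV[K]_k) m : (m <= n)%N ->
  (forall S : {set 'I_n.+1}, #|S| = m.+1 -> lin_indep S a) -> a ord0 != 0.
Proof.
move=> le_mn indep; have [|B sB cB] := @subset_of_card _ [set~ ord0 : 'I_n.+1] m.
  by rewrite cardsC1 card_ord.
have B0 : ord0 \notin B by apply/negP => /(fintype.subsetP sB); rewrite !inE eqxx.
apply/eqP => a0; suff /eqP : 1 = 0 :> K by rewrite oner_eq0.
have := indep (ord0 |: B) _ (fun i => (i == ord0)%:R) _ ord0.
rewrite eqxx finset.setU11; apply => //; first by rewrite cardsU1 B0 cB.
rewrite big_setU1 //= a0 scaler0 add0r big1 // => i iB.
by rewrite (negbTE (memPn B0 i iB)) scale0r.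
Qed.

(** A combination [w] of the other forms that restricts to 0 equals [(w u)] times [a ord0], so a
    relation among [m] restrictions lifts to one among [m.+1] original forms. *)
Lemma indep_restriction k l n (M : 'M[K]_(k, l)) (N : 'M[K]_(l, k)) u
    (a : 'I_n.+1 -> 'rV[K]_k) m :
  u *m a ord0 + M *m N = 1%:M ->
  (forall S : {set 'I_n.+1}, #|S| = m.+1 -> lin_indep S a) ->
  forall S : {set 'I_n}, #|S| = m ->
    lin_indep S (fun i => a (lift ord0 i) *m M).
Proof.
move=> uaMN indep S cS c sumc i iS.
pose w := \sum_(i in S) c i *: a (lift ord0 i).
have wM : w *m M = 0.
  rewrite -sumc /w mulmx_suml; by apply: eq_bigr => j _; rewrite scalemxAl.
have def_w : w = (w *m u) 0 0 *: a ord0.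
  rewrite -mul_scalar_mx -mx11_scalar -mulmxA -[LHS]mulmx1 -uaMN mulmxDr.
  by rewrite [w *m (M *m N)]mulmxA wM mul0mx addr0.
have S0 : ord0 \notin [set lift ord0 i | i in S].
  by apply/imsetP => -[j _ /eqP]; rewrite (negbTE (neq_lift _ _)).
pose c' j := if unlift ord0 j is Some j' then c j' else - (w *m u) 0 0.
have := indep (ord0 |: [set lift ord0 i | i in S]) _ c' _ (lift ord0 i).
rewrite {2}/c' liftK; apply.
- by rewrite cardsU1 S0 card_imset ?cS //; apply: lift_inj.
- rewrite big_setU1 //= big_imset => [|j j' _ _]; last exact: lift_inj.
  rewrite /= {1}/c' unlift_none scaleNr -def_w addrC; apply/eqP.
  rewrite subr_eq0; apply/eqP; apply: eq_bigr => j _.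
  by rewrite /c' liftK.
- by rewrite inE imset_f ?orbT.
Qed.

(** The form [a ord0] kills [M *m v], so any competitor [w] lies on its hyperplane, where
    [w = M (N w)]; the hypothesis then applies to [N w]. *)
Lemma coatom_vector_restriction k l n (M : 'M[K]_(k, l)) (N : 'M[K]_(l, k)) u
    (a : 'I_n.+1 -> 'rV[K]_k) v :
  a ord0 *m M = 0 -> N *m M = 1%:M -> u *m a ord0 + M *m N = 1%:M ->
  coatom_vector (fun i => a (lift ord0 i) *m M) v -> coatom_vector a (M *m v).
Proof.
move=> aM NM uaMN [v0 vP]; split.
  apply: contraNneq v0 => Mv; by rewrite -[v]mul1mx -NM -mulmxA Mv mulmx0.
move=> w wP; have aw : a ord0 *m w = 0 by apply: wP; rewrite mulmxA aM mul0mx.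
have def_w : w = M *m (N *m w).
  by rewrite -[LHS]mul1mx -uaMN mulmxDl -mulmxA aw mulmx0 add0r mulmxA.
have [|c def_Nw] := vP (N *m w); last by exists c; rewrite def_w def_Nw scalemxAr.
by move=> i; rewrite -!mulmxA -def_w; apply: wP.
Qed.

Lemma coatom_vector_deletion k n (a : 'I_n.+1 -> 'rV[K]_k) v :
  coatom_vector (fun i => a (lift ord0 i)) v -> coatom_vector a v.
Proof. by move=> [v0 vP]; split=> // w wP; apply: vP => i; apply: wP. Qed.

Lemma card_forms_through k n (a : 'I_n.+1 -> 'rV[K]_k) v :
  #|forms_through a v| =
    ((a ord0 *m v == 0)%R + #|forms_through (fun i => a (lift ord0 i)) v|)%N.
Proof.
rewrite (cardsD1 ord0) !inE; congr (_ + _)%N.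
rewrite -[RHS](card_imset _ (@lift_inj _ ord0)); apply: eq_card => i.
have [j ->|->] := unliftP ord0 i.
  by rewrite !inE eq_sym neq_lift mem_imset ?inE //; apply: lift_inj.
rewrite !inE; apply/esym/negbTE/imsetP => -[j _ /eqP].
by rewrite (negbTE (neq_lift _ _)).
Qed.

Lemma fold_products_of_vanishing k n (a : 'I_n -> 'rV[K]_k.+1) f :
  (forall S : {set 'I_n}, #|S| = k -> lin_indep S a) ->
  (forall v, coatom_vector a v ->
     vanishing v (#|forms_through a v| + 1 - k) f) ->
  fold_products_ideal (fun i => lin (a i)) (n + 1 - k) f.
Proof.
elim: k n a f => [|k IHk] n a f.
  move=> _ van; have [I0 _ _] :=
    fold_products_is_ideal (fun i => lin (a i)) (n + 1 - 0).
  (* In one variable the whole line is itself a coatom, with prescribed order at least 1. *)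
  suff -> : f = 0 by [].
  apply: vanishing_univariate; apply: vanishing_le (van _ _).
    by rewrite subn0 leq_addl.
  split=> [|w _].
    by apply/eqP => /matrixP/(_ 0 0); rewrite !mxE => /eqP; rewrite oner_eq0.
  by exists (w 0 0); apply/colP => i; rewrite ord1 !mxE mulr1.
elim: n a f => [|n IHn] a f indep van; first exact: fold_products0.
(* For at most [k] forms the truncated exponent is [0]: both ideals are
   the whole ring. *)
have [lt_nk|le_kn] := ltnP n k.
  by have -> : (n.+1 + 1 - k.+1 = 0)%N by [lia]; apply: fold_products0.
have a0 := indep_neq0 le_kn indep.
have [M [N [u [aM NM uaMN]]]] := hyperplane_splitting a0.
have [|g Ig def_g] := fold_products_restriction (a := a) (m := (n + 1 - k)%N)
  (g := mxsubst M f) NM.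
  apply: IHk; first exact: indep_restriction uaMN indep.
  move=> v vP; apply: vanishing_mxsubst.
  have /van := coatom_vector_restriction aM NM uaMN vP.
  rewrite card_forms_through mulmxA aM mul0mx eqxx add1n addSn subSS.
  congr vanishing; congr (_ + _ - _)%N; apply: eq_card => i.
  by rewrite !inE mulmxA.
have [h def_h] : exists h, f - g = lin (a ord0) * h.
  by apply: mxsubst_ker uaMN _; rewrite rmorphB /= def_g subrr.
have -> : f = lin (a ord0) * h + g by rewrite -def_h subrK.
have [_ ID _] := fold_products_is_ideal (fun i => lin (a i))
  (n.+1 + 1 - k.+1).
apply: ID; last by rewrite addSn subSS.
have -> : (n.+1 + 1 - k.+1 = (n + 1 - k.+1).+1)%N by lia.
apply: (@fold_products_deletion _ _ (fun i => lin (a i))).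
apply: IHn => [S cS c sumc i iS|v vP].
  (* A relation after deletion is extended by the coefficient 0 at [ord0]. *)
  have := indep [set lift ord0 i | i in S] _
    (fun j => if unlift ord0 j is Some j' then c j' else 0) _ (lift ord0 i).
  rewrite liftK; apply; first by rewrite card_imset //; apply: lift_inj.
    rewrite big_imset => [|j j' _ _]; last exact: lift_inj.
    by rewrite -[RHS]sumc; apply: eq_bigr => j _; rewrite liftK.
  exact: imset_f.
have avP := coatom_vector_deletion vP.
have [_ VD VM] := vanishing_is_ideal v (#|forms_through a v| + 1 - k.+1).
(* Dividing by [lin (a ord0)] costs one order exactly when this form passes through [v], which is
   also when deleting it lowers the count of forms through [v]. *)
have /(vanishing_lin_mul a0) : vanishing v (#|forms_through a v| + 1 - k.+1)
    (lin (a ord0) * h).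
  rewrite -def_h -mulN1r; apply: VD; first exact: van.
  apply/VM/(vanishing_le _ (fold_products_vanishing v Ig)).
  have := max_card (forms_through a v); rewrite card_ord; lia.
by apply: vanishing_le; rewrite card_forms_through; case: (a ord0 *m v == 0) => /=; lia.
Qed.

(** * From coatom vectors to flats *)

Lemma mem_hyperplane_lin k (a w : 'rV[K]_k) :
  (w \in hyperplane (lin a)) = (a *m w^T == 0).
Proof.
rewrite mem_hyperplane ?lin_form // -{1}[w]trmxK meval_lin.
apply/eqP/eqP => [aw|->]; last by rewrite mxE.
by apply/matrixP => i j; rewrite !ord1 aw mxE.
Qed.

Lemma line_sub_hyperplane k (a : 'rV[K]_k) (v : 'cV[K]_k) :
  (<[v^T]> <= hyperplane (lin a))%VS = (a *m v == 0).
Proof. by rewrite -memvE mem_hyperplane_lin trmxK. Qed.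

Lemma nu_line k n (a : 'I_n -> 'rV[K]_k) v :
  nu (fun i => lin (a i)) <[v^T]>%VS = #|forms_through a v|.
Proof. by apply: eq_card => i; rewrite !inE line_sub_hyperplane. Qed.

(** The line is the intersection of all hyperplanes containing [v]: a vector on all of them is a
    multiple of [v] by the choice of [v]. *)
Lemma flats_line k n (a : 'I_n -> 'rV[K]_k) v :
  coatom_vector a v -> flats (fun i => lin (a i)) (k - 1) <[v^T]>%VS.
Proof.
move=> [v0 vP]; split; last by rewrite /codim dim_vline trmx_eq0 v0.
exists (forms_through a v); apply/eqP; rewrite eqEsubv; apply/andP; split.
  by apply/subv_bigcapP => i; rewrite inE line_sub_hyperplane.
apply/subvP => w; rewrite memvE => /subv_bigcapP wP.
have [|c def_w] := vP w^T.
  move=> i /eqP av; apply/eqP; rewrite -mem_hyperplane_lin memvE.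
  by apply: wP; rewrite inE.
by apply/vlineP; exists c; rewrite -[w]trmxK def_w linearZ.
Qed.

Lemma form_ideal_vanishing k (v : 'cV[K]_k) :
  (form_ideal <[v^T]>%VS `<=` vanishing v 1)%classic.
Proof.
apply: ideal_gen_sub; first exact: vanishing_is_ideal.
move=> l [/form_lin -> l0]; apply: vanishing_lin.
apply/eqP; rewrite -line_sub_hyperplane; apply/subvP => w wv.
by rewrite mem_hyperplane ?lin_form // l0.
Qed.

Lemma fold_products_coatoms k n (a : 'I_n -> 'rV[K]_k.+1) :
  (forall S : {set 'I_n}, #|S| = k -> lin_indep S a) ->
  fold_products_ideal (fun i => lin (a i)) (n + 2 - k.+1)
  = (\bigcap_(X in flats (fun i => lin (a i)) (k.+1 - 1))
      ideal_pow (form_ideal X) (nu (fun i => lin (a i)) X + 2 - k.+1))%classic.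
Proof.
move=> indep; apply/seteqP; split=> f.
  move=> If X _.
  pose Z := [set i | (X <= hyperplane (lin (a i)))%VS].
  apply: (fold_products_sub_pow (Z := Z) _ _ If) => [i|].
    rewrite inE => /subvP sX; apply: ideal_gen_incl.
    by split=> [|v /sX]; [apply: lin_form|rewrite mem_hyperplane ?lin_form // => /eqP].
  (* This bound covers the truncated case: when [n + 2 - k.+1] is cut off at 0, so is the exponent
     at [X]. *)
  have leZ : (#|Z| <= n)%N by rewrite -[leqRHS]card_ord max_card.
  have -> : nu (fun i => lin (a i)) X = #|Z| by [].
  by move: #|Z| leZ => z; lia.
move=> If; have -> : (n + 2 - k.+1 = n + 1 - k)%N by lia.
apply: fold_products_of_vanishing => // v vP; apply: ideal_pow_vanishing.
apply: ideal_pow_subset (@form_ideal_vanishing _ v) _ _.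
have -> : (#|forms_through a v| + 1 - k = #|forms_through a v| + 2 - k.+1)%N by lia.
by rewrite -nu_line; apply: If; apply: flats_line.
Qed.
End Forms.

Theorem proposition2p1 (K : fieldType) (k n : nat) (L : 'I_n -> {mpoly K[k]})
    (k_gt0 : (0 < k)%N)
    (L_form : forall i, linear_form (L i))
    (L_neq0 : forall i, L i != 0)
    (H_distinct : injective (fun i => hyperplane (L i)))
    (A_essential : essential L)
    (A_generic : all_indep L (k - 1)) :
  fold_products_ideal L (n + 2 - k)
  = (\bigcap_(X in flats L (k - 1)) ideal_pow (form_ideal X) (nu L X + 2 - k))%classic.
Proof.
case: k k_gt0 => // k _ in L L_form L_neq0 H_distinct A_essential A_generic *.
have [a def_L] : exists a : 'I_n -> 'rV[K]_k.+1, L = fun i => lin (a i).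
  exists (fun i => \row_j (L i)@_(U_(j))).
  by apply: boolp.funext => i; apply: form_lin.
rewrite def_L in A_generic *; apply: fold_products_coatoms => S cS c sumc.
apply: A_generic; first by rewrite subn1.
(* The linear map [lin] carries a relation between coefficient rows to one between forms. *)
by under eq_bigr do rewrite -linearZ /=; rewrite -linear_sum sumc linear0.
Qed.
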